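(* Let $n\ge 3$, let $\beta\in B_n/[P_n,P_n]$, let $\theta=\overline{\sigma}(\beta^{-1})\in S_n$, and let $T_\theta$ be a transversal of the action of $\langle\theta\rangle$ on $\mathcal{B}=\{A_{i,j}\mid 1\le i<j\le n\}$. Suppose that $\tilde{C}\in\overline{\sigma}^{-1}(C_{S_n}(\theta))$ and let $C=\overline{\sigma}(\tilde{C})$. Let $c_{i,j}\in\mathbb{Z}$, for $1\le i<j\le n$, be such that $\tilde{C}\beta\tilde{C}^{-1}=\beta\prod_{1\le i<j\le n}A_{i,j}^{c_{i,j}}$. Let $z_{t,q},b_{t,q}\in\mathbb{Z}$ for all $A_{t,q}\in T_\theta$. Then the elements $$\beta\prod_{A_{t,q}\in T_{\theta}}A_{t,q}^{z_{t,q}}\quad\text{and}\quad\beta\prod_{A_{t,q}\in T_{\theta}}A_{t,q}^{b_{t,q}}$$ are conjugate in $B_n/[P_n,P_n]$ if and only if, for every $A_{t,q}\in T_\theta$: (i) $\sum_{A_{i,j}\in\mathcal{O}_{\theta}(A_{t,q})}c_{i,j}+z_{C(t),C(q)}=b_{t,q}$ if $A_{C^{-1}(t),C^{-1}(q)}\notin\mathcal{O}_{\theta}(A_{t,q})$, where $z_{C(t),C(q)}=\sum_{A_{i,j}\in\mathcal{O}_{\theta}(A_{C(t),C(q)})}a_{i,j}$ and $a_{i,j}\in\mathbb{Z}$ is the exponent of $A_{i,j}$ in the product $\prod_{A_{t,q}\in T_\theta}A_{t,q}^{z_{t,q}}$ (so $a_{i,j}=z_{i,j}$ if $A_{i,j}\in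 T_\theta$ and $a_{i,j}=0$ otherwise); (ii) $\sum_{A_{i,j}\in\mathcal{O}_{\theta}(A_{t,q})}c_{i,j}+z_{t,q}=b_{t,q}$ if $A_{C^{-1}(t),C^{-1}(q)}\in\mathcal{O}_{\theta}(A_{t,q})$.
   Context: $B_n$ is the Artin braid group with generators $\sigma_1,\dots,\sigma_{n-1}$ and relations $\sigma_i\sigma_{i+1}\sigma_i=\sigma_{i+1}\sigma_i\sigma_{i+1}$ for $1\le i\le n-2$ and $\sigma_i\sigma_j=\sigma_j\sigma_i$ for $|i-j|\ge 2$. The homomorphism $\sigma\colon B_n\to S_n$ is given by $\sigma(\sigma_i)=(i,i+1)$, where permutations are multiplied from left to right: $(\alpha\cdot\beta)(i)=\beta(\alpha(i))$. The pure braid group is $P_n=\ker\sigma$, and $[P_n,P_n]$ is its commutator subgroup. $\overline{\sigma}\colon B_n/[P_n,P_n]\to S_n$ is the surjective homomorphism induced by $\sigma$, with kernel $P_n/[P_n,P_n]$. $C_{S_n}(\theta)$ denotes the centralizer of $\theta$ in $S_n$. For $1\le i<j\le n$ put $A_{i,j}=\sigma_{j-1}\cdots\sigma_{i+1}\sigma_i^2\sigma_{i+1}^{-1}\cdots\sigma_{j-1}^{-1}\in P_n$ and $A_{j,i}=A_{i,j}$; exponents indexed by pairs satisfy $m_{j,i}=m_{i,j}$. The same symbols denote the classes in $B_n/[P_n,P_n]$; these classes form a basis of the free abelian group $P_n/[P_n,P_n]$. Conjugation satisfies $\alpha A_{i,j}\alpha^{-1}=A_{\pi(i),\pi(j)}$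 for $\alpha\in B_n/[P_n,P_n]$ and $\pi=\overline{\sigma}(\alpha^{-1})$. For $\theta\in S_n$, the cyclic group $\langle\theta\rangle$ acts on $\mathcal{B}=\{A_{i,j}\mid 1\le i<j\le n\}$ by $\theta^k(A_{i,j})=A_{\theta^k(i),\theta^k(j)}$. $\mathcal{O}_\theta(A_{r,s})$ denotes the orbit of $A_{r,s}$ under this action, and a transversal $T_\theta$ is a subset of $\mathcal{B}$ containing exactly one element of each orbit.
   Formalization: For a fixed C̃, ''conjugate implies (i),(ii)'' fails (n=3, β=1, C̃=1: A_{1,2} and A_{2,3} are conjugate but z≠b), so the formal statement says: conjugate iff (i),(ii) hold for some C̃ over the centralizer of θ, with its exponents c. *)

(* Defs.v *)
From HB Require Import structures.
From mathcomp Require Import all_boot all_order all_algebra all_fingroup.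
From mathcomp Require Import generic_quotient boolp zify.
Set Implicit Arguments.
Unset Strict Implicit.
Unset Printing Implicit Defensive.
Local Open Scope group_scope.
Local Open Scope quotient_scope.

(* The letter [(i, true)] stands for the generator [i], and [(i, false)] for
   its formal inverse. *)

Definition word (I : choiceType) : choiceType := seq (I * bool).

Definition winv (I : choiceType) (w : word I) : word I :=
  rev [seq (l.1, ~~ l.2) | l <- w].

Inductive pres_eq (I : choiceType) (R : word I -> word I -> Prop) :
    word I -> word I -> Prop :=
| pres_refl u : pres_eq R u u
| pres_sym u v : pres_eq R u v -> pres_eq R v u
| pres_trans v u w : pres_eq R u v -> pres_eq R v w -> pres_eq R u w
| pres_cat u u' v v' :
    pres_eq R u u' -> pres_eq R v v' -> pres_eq R (u ++ v) (u' ++ v')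
| pres_cancel i e : pres_eq R [:: (i, e); (i, ~~ e)] [::]
| pres_rel u v : R u v -> pres_eq R u v.

Section PresentedGroup.
Variables (I : choiceType) (R : word I -> word I -> Prop).

Definition pres_eqb (u v : word I) : bool := `[< pres_eq R u v >].

Lemma pres_eqb_refl : reflexive pres_eqb.
Proof. by move=> u; apply/asboolP/pres_refl. Qed.

Lemma pres_eqb_sym : symmetric pres_eqb.
Proof. by move=> u v; apply/asboolP/asboolP => /pres_sym. Qed.

Lemma pres_eqb_trans : transitive pres_eqb.
Proof.
move=> v u w /asboolP uv /asboolP vw.
exact/asboolP/(pres_trans uv vw).
Qed.

Canonical pres_equiv := EquivRel pres_eqb pres_eqb_refl pres_eqb_sym
  pres_eqb_trans.

Definition pres_group := {eq_quot pres_equiv}.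
HB.instance Definition _ := Choice.on pres_group.
HB.instance Definition _ := EqQuotient.on pres_group.

Lemma pres_piP (u v : word I) :
  \pi_pres_group u = \pi_pres_group v <-> pres_eq R u v.
Proof. by split=> [/eqmodP/asboolP|uv] //; apply/eqmodP/asboolP. Qed.

Lemma pres_reprP (u : word I) : pres_eq R (repr (\pi_pres_group u)) u.
Proof. by apply/pres_piP; rewrite reprK. Qed.

Lemma pres_winvV (w : word I) : pres_eq R (winv w ++ w) [::].
Proof.
elim: w => [|[i e] w IHw]; first exact: pres_refl.
rewrite /winv map_cons rev_cons cat_rcons.
apply: pres_trans IHw; apply: pres_cat; first exact: pres_refl.
rewrite -[X in pres_eq _ _ X]cat0s -[X in pres_eq _ X _]/([:: _; _] ++ w).
apply: pres_cat; last exact: pres_refl.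
by have := pres_cancel R i (~~ e); rewrite negbK.
Qed.

Lemma winvK : involutive (@winv I).
Proof.
move=> w; rewrite /winv map_rev revK -map_comp.
by rewrite (@eq_map _ _ _ id) ?map_id // => -[i e] /=; rewrite negbK.
Qed.

Lemma pres_winv (w : word I) : pres_eq R (w ++ winv w) [::].
Proof. by rewrite -{1}(winvK w); apply: pres_winvV. Qed.

Definition pres_mul (x y : pres_group) : pres_group :=
  \pi_pres_group (repr x ++ repr y).
Definition pres_one : pres_group := \pi_pres_group [::].
Definition pres_inv (x : pres_group) : pres_group :=
  \pi_pres_group (winv (repr x)).

Lemma pres_mulA : associative pres_mul.
Proof.
move=> x y z; apply/pres_piP.
apply: (@pres_trans _ _ (repr x ++ repr y ++ repr z)).
  exact: pres_cat (pres_refl _ _) (pres_reprP _).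
rewrite catA; apply: pres_sym.
exact: pres_cat (pres_reprP _) (pres_refl _ _).
Qed.

Lemma pres_mul1g : left_id pres_one pres_mul.
Proof.
move=> x; rewrite -[RHS]reprK; apply/pres_piP.
exact: (pres_cat (pres_reprP [::]) (pres_refl _ _)).
Qed.

Lemma pres_mulg1 : right_id pres_one pres_mul.
Proof.
move=> x; rewrite -[RHS]reprK; apply/pres_piP.
rewrite -[X in pres_eq _ _ X]cats0.
exact: (pres_cat (pres_refl _ _) (pres_reprP [::])).
Qed.

Lemma pres_mulVg : left_inverse pres_one pres_inv pres_mul.
Proof.
move=> x; apply/pres_piP; apply: pres_trans (pres_winvV (repr x)).
exact: (pres_cat (pres_reprP _) (pres_refl _ _)).
Qed.

Lemma pres_mulgV : right_inverse pres_one pres_inv pres_mul.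
Proof.
move=> x; apply/pres_piP; apply: pres_trans (pres_winv (repr x)).
exact: (pres_cat (pres_refl _ _) (pres_reprP _)).
Qed.

HB.instance Definition _ := isGroup.Build pres_group
  pres_mulA pres_mul1g pres_mulg1 pres_mulVg pres_mulgV.

Definition pres_gen (i : I) : pres_group := \pi_pres_group [:: (i, true)].

End PresentedGroup.

Section PresentedGroupLift.
Variables (I : choiceType) (R : word I -> word I -> Prop) (H : groupType).
Variable f : I -> H.

Definition word_eval (w : word I) : H :=
  \prod_(l <- w) (if l.2 then f l.1 else (f l.1)^-1).

Definition pres_lift (x : pres_group R) : H := word_eval (repr x).

Lemma word_evalM u v : word_eval (u ++ v) = word_eval u * word_eval v.
Proof. by rewrite /word_eval big_cat. Qed.

Hypothesis fR : forall u v, R u v -> word_eval u = word_eval v.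

Lemma word_eval_pres u v : pres_eq R u v -> word_eval u = word_eval v.
Proof.
elim=> {u v} [|u v _ ->|v u w _ -> _ ->|u u' v v' _ uu' _ vv'|i e|] //.
- by rewrite !word_evalM uu' vv'.
- rewrite /word_eval !big_cons big_nil mulg1 /=.
  by case: e; rewrite ?mulgV ?mulVg.
Qed.

Lemma pres_lift_pi u : pres_lift (\pi_(pres_group R) u) = word_eval u.
Proof. exact/word_eval_pres/pres_reprP. Qed.

Lemma pres_lift_gen i : pres_lift (pres_gen R i) = f i.
Proof. by rewrite pres_lift_pi /word_eval big_seq1. Qed.

Lemma pres_lift_morphism : monoid_morphism pres_lift.
Proof.
split=> [|x y]; first by rewrite pres_lift_pi /word_eval big_nil.
by rewrite pres_lift_pi word_evalM.
Qed.

End PresentedGroupLift.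

Record normal_subgroup (G : groupType) := NormalSubgroup {
  nsub_pred :> {pred G};
  nsub1 : 1 \in nsub_pred;
  nsubM : forall x y, x \in nsub_pred -> y \in nsub_pred -> x * y \in nsub_pred;
  nsubV : forall x, x \in nsub_pred -> x^-1 \in nsub_pred;
  nsubJ : forall x g, x \in nsub_pred -> x ^ g \in nsub_pred
}.

Section QuotientGroup.
Variables (G : groupType) (N : normal_subgroup G).

Definition coset_eq (x y : G) : bool := x^-1 * y \in nsub_pred N.

Lemma coset_eq_refl : reflexive coset_eq.
Proof. by move=> x; rewrite /coset_eq mulVg nsub1. Qed.

Lemma coset_eq_sym : symmetric coset_eq.
Proof.
suff sym x y : coset_eq x y -> coset_eq y x.
  by move=> x y; apply/idP/idP; apply: sym.
by rewrite /coset_eq => /nsubV; rewrite invgM invgK.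
Qed.

Lemma coset_eq_trans : transitive coset_eq.
Proof.
by rewrite /coset_eq => y x z /nsubM xy /xy; rewrite mulgA mulgK.
Qed.

Canonical coset_equiv := EquivRel coset_eq coset_eq_refl coset_eq_sym
  coset_eq_trans.

Definition quot_group := {eq_quot coset_equiv}.
HB.instance Definition _ := Choice.on quot_group.
HB.instance Definition _ := EqQuotient.on quot_group.

Definition quot_proj (x : G) : quot_group := \pi_quot_group x.

Lemma quot_projP x y : quot_proj x = quot_proj y <-> coset_eq x y.
Proof. by split=> [/eqmodP|xy] //; apply/eqmodP. Qed.

Lemma quot_reprP x : coset_eq (repr (quot_proj x)) x.
Proof. by apply/quot_projP; rewrite /quot_proj reprK. Qed.

Lemma quot_reprK (x : quot_group) : quot_proj (repr x) = x.
Proof. exact: reprK. Qed.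

Lemma coset_eqM x x' y y' :
  coset_eq x x' -> coset_eq y y' -> coset_eq (x * y) (x' * y').
Proof.
rewrite /coset_eq => xx' yy'.
have -> : (x * y)^-1 * (x' * y') = (x^-1 * x') ^ y * (y^-1 * y').
  by rewrite conjgE invgM !mulgA mulgK.
by apply: nsubM yy'; apply: nsubJ.
Qed.

Lemma coset_eqV x x' : coset_eq x x' -> coset_eq x^-1 x'^-1.
Proof.
rewrite /coset_eq => xx'.
have -> : x^-1^-1 * x'^-1 = ((x^-1 * x')^-1) ^ x^-1.
  by rewrite conjgE invgM !invgK !mulgA mulgK.
exact/nsubJ/nsubV.
Qed.

Definition quot_mul (x y : quot_group) := quot_proj (repr x * repr y).
Definition quot_one := quot_proj 1.
Definition quot_inv (x : quot_group) := quot_proj (repr x)^-1.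

Lemma quot_mulE x y : quot_mul (quot_proj x) (quot_proj y) = quot_proj (x * y).
Proof. exact/quot_projP/coset_eqM/quot_reprP/quot_reprP. Qed.

Lemma quot_invE x : quot_inv (quot_proj x) = quot_proj x^-1.
Proof. exact/quot_projP/coset_eqV/quot_reprP. Qed.

Lemma quot_mulA : associative quot_mul.
Proof.
move=> x y z; rewrite -(quot_reprK x) -(quot_reprK y) -(quot_reprK z).
by rewrite !quot_mulE mulgA.
Qed.

Lemma quot_mul1g : left_id quot_one quot_mul.
Proof. by move=> x; rewrite -(quot_reprK x) quot_mulE mul1g. Qed.

Lemma quot_mulg1 : right_id quot_one quot_mul.
Proof. by move=> x; rewrite -(quot_reprK x) quot_mulE mulg1. Qed.

Lemma quot_mulVg : left_inverse quot_one quot_inv quot_mul.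
Proof. by move=> x; rewrite -(quot_reprK x) quot_invE quot_mulE mulVg. Qed.

Lemma quot_mulgV : right_inverse quot_one quot_inv quot_mul.
Proof. by move=> x; rewrite -(quot_reprK x) quot_invE quot_mulE mulgV. Qed.

HB.instance Definition _ := isGroup.Build quot_group
  quot_mulA quot_mul1g quot_mulg1 quot_mulVg quot_mulgV.

Lemma quot_proj_morphism : monoid_morphism quot_proj.
Proof. by split=> // x y; rewrite -quot_mulE. Qed.

HB.instance Definition _ := isUMagmaMorphism.Build G quot_group quot_proj
  quot_proj_morphism.

End QuotientGroup.

Inductive generated (G : groupType) (S : G -> Prop) : G -> Prop :=
| gen_mem x : S x -> generated S x
| gen_one : generated S 1
| gen_mul x y : generated S x -> generated S y -> generated S (x * y)
| gen_inv x : generated S x -> generated S x^-1.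

Definition commutator_sub (G : groupType) (H : {pred G}) : {pred G} :=
  fun x => `[< generated
    (fun y => exists a b, [/\ a \in H, b \in H & y = [~ a, b]]) x >].

Lemma commutator_sub1 (G : groupType) (H : {pred G}) : 1 \in commutator_sub H.
Proof. exact/asboolP/gen_one. Qed.

Lemma commutator_subM (G : groupType) (H : {pred G}) x y :
  x \in commutator_sub H -> y \in commutator_sub H ->
  x * y \in commutator_sub H.
Proof. by move=> /asboolP Hx /asboolP Hy; apply/asboolP/gen_mul. Qed.

Lemma commutator_subV (G : groupType) (H : {pred G}) x :
  x \in commutator_sub H -> x^-1 \in commutator_sub H.
Proof. by move=> /asboolP Hx; apply/asboolP/gen_inv. Qed.

Lemma commutator_subJ (G : groupType) (H : {pred G})
    (HJ : forall a g, a \in H -> a ^ g \in H) x g :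
  x \in commutator_sub H -> x ^ g \in commutator_sub H.
Proof.
move=> /asboolP Hx; apply/asboolP; elim: Hx => {x} [x|||].
- move=> [a [b [Ha Hb ->]]]; apply: gen_mem; exists (a ^ g), (b ^ g).
  by rewrite !HJ // conjRg.
- by rewrite conj1g; apply: gen_one.
- by move=> x y _ Hx _ Hy; rewrite conjMg; apply: gen_mul.
- by move=> x _ Hx; rewrite conjVg; apply: gen_inv.
Qed.

(* Strands are indexed from 0: [k : 'I_n.-1] is the generator usually written
   sigma_(k+1), whose permutation exchanges [k] and [k.+1]. *)

Inductive braid_rel (n : nat) : word 'I_n.-1 -> word 'I_n.-1 -> Prop :=
| braid_rel_braid (i j : 'I_n.-1) : j = i.+1 :> nat ->
    braid_rel [:: (i, true); (j, true); (i, true)]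
              [:: (j, true); (i, true); (j, true)]
| braid_rel_comm (i j : 'I_n.-1) : i.+1 < j ->
    braid_rel [:: (i, true); (j, true)] [:: (j, true); (i, true)].

Definition braid (n : nat) : groupType := pres_group (@braid_rel n).

Definition ord_low n (k : 'I_n.-1) : 'I_n := widen_ord (leq_pred n) k.

Lemma ord_high_subproof n (k : 'I_n.-1) : k.+1 < n.
Proof. by case: n k => [|n] [k]. Qed.

Definition ord_high n (k : 'I_n.-1) : 'I_n := Ordinal (ord_high_subproof k).

(* Permutations compose from left to right: [(s * t) x = t (s x)] (permM). *)
Definition braid_perm (n : nat) (x : braid n) : 'S_n :=
  pres_lift (fun k => tperm (ord_low k) (ord_high k)) x.

Lemma braid_perm_rel n (u v : word 'I_n.-1) : braid_rel u v ->
  let f k := tperm (ord_low k) (ord_high k) : 'S_n in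
  word_eval f u = word_eval f v.
Proof.
case=> i j ij f; rewrite /word_eval !big_cons !big_nil !mulg1 /=.
  have -> : f j = tperm (ord_high i) (ord_high j).
    by congr (tperm _ _); apply: val_inj; rewrite /= ij.
  rewrite /f; set a := ord_low i; set b := ord_high i; set c := ord_high j.
  have ab : a != b by rewrite -val_eqE /= neq_ltn ltnSn.
  have ac : a != c by rewrite -val_eqE /= ij neq_ltn ltnS leqnSn.
  have bc : b != c by rewrite -val_eqE /= ij neq_ltn ltnSn.
  have tpJ (s t x y : 'I_n) :
      tperm s t * (tperm x y * tperm s t) = tperm (tperm s t x) (tperm s t y).
    by rewrite -tpermJ conjgE tpermV.
  by rewrite !tpJ tpermL tpermR (tpermD ac bc) tpermD // eq_sym.
have disj x : x != ord_low i -> x != ord_high i -> f i x = x.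
  by move=> xi xi'; rewrite /f tpermD // eq_sym.
have fiJ : f j = f j ^ f i.
  by rewrite tpermJ !disj // -val_eqE /= neq_ltn; apply/orP; right; lia.
by rewrite [RHS]conjgC -fiJ.
Qed.

Lemma braid_perm_morphism n : monoid_morphism (@braid_perm n).
Proof. exact/pres_lift_morphism/braid_perm_rel. Qed.

HB.instance Definition _ n := isUMagmaMorphism.Build (braid n) 'S_n
  (@braid_perm n) (@braid_perm_morphism n).

Lemma braid_perm_gen n (k : 'I_n.-1) :
  braid_perm (pres_gen (@braid_rel n) k) = tperm (ord_low k) (ord_high k).
Proof. exact/pres_lift_gen/braid_perm_rel. Qed.

Definition pure_braid (n : nat) : {pred braid n} :=
  fun x => braid_perm x == 1.

Lemma pure_braidJ n (x g : braid n) :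
  x \in @pure_braid n -> x ^ g \in @pure_braid n.
Proof. by move=> /eqP px; apply/eqP; rewrite gmulfJ /= px conj1g. Qed.

Definition pure_comm (n : nat) : normal_subgroup (braid n) :=
  NormalSubgroup (commutator_sub1 _) (@commutator_subM _ (@pure_braid n))
    (@commutator_subV _ _) (@commutator_subJ _ _ (@pure_braidJ n)).

Definition braid_ab (n : nat) : groupType := quot_group (pure_comm n).

Lemma braid_perm_pure_comm n (x : braid n) :
  x \in pure_comm n -> braid_perm x = 1.
Proof.
move=> /asboolP; elim=> {x} [x [a [b [/eqP Ha /eqP Hb ->]]]||x y _ Hx _ Hy|].
- by rewrite gmulfR /= Ha Hb comm1g.
- exact: gmulf1.
- by rewrite gmulfM /= Hx Hy mulg1.
- by move=> x _ Hx; rewrite gmulfV /= Hx invg1.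
Qed.

Definition sigma_bar (n : nat) (x : braid_ab n) : 'S_n := braid_perm (repr x).

Lemma sigma_bar_proj n (x : braid n) :
  sigma_bar (quot_proj (pure_comm n) x) = braid_perm x.
Proof.
have /braid_perm_pure_comm := quot_reprP (pure_comm n) x.
by rewrite gmulfM gmulfV => /(canRL (mulKVg _)); rewrite mulg1.
Qed.

Lemma sigma_bar_morphism n : monoid_morphism (@sigma_bar n).
Proof.
split=> [|x y]; first by rewrite sigma_bar_proj gmulf1.
by rewrite sigma_bar_proj gmulfM.
Qed.

HB.instance Definition _ n := isUMagmaMorphism.Build (braid_ab n) 'S_n
  (@sigma_bar n) (@sigma_bar_morphism n).

(* The generator of index [k]; it is the identity when [n <= k.+1]. *)
Definition braid_gen (n k : nat) : braid n :=
  if insub k is Some i then pres_gen (@braid_rel n) i else 1.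

(* A_(i,j), to be used for [i < j < n]. *)
Definition braidA (n i j : nat) : braid n :=
  let w := \prod_(k <- rev (index_iota i.+1 j)) braid_gen n k in
  w * braid_gen n i ^+ 2 * w^-1.

Definition Aij (n : nat) (i j : 'I_n) : braid_ab n :=
  quot_proj (pure_comm n) (braidA n i j).

Definition expgz (G : groupType) (x : G) (m : int) : G :=
  match m with Posz k => x ^+ k | Negz k => x ^- k.+1 end.

(* The basis element A_(i,j) = A_(j,i) is labelled by the 2-element set
   [[set i; j]]; accordingly a family of exponents m_(i,j) = m_(j,i) is a
   function on sets, of which only the values at 2-element sets are used. *)
Definition prodA (n : nat) (m : {set 'I_n} -> int) : braid_ab n :=
  \prod_(i < n) \prod_(j < n | i < j) expgz (Aij i j) (m [set i; j]).

Definition prodA_on (n : nat) (T : {set {set 'I_n}}) (m : {set 'I_n} -> int) :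
    braid_ab n :=
  \prod_(i < n) \prod_(j < n | (i < j) && ([set i; j] \in T))
    expgz (Aij i j) (m [set i; j]).

Definition basisA (n : nat) : {set {set 'I_n}} := [set E : {set 'I_n} | #|E| == 2].

(* ['P^*] is the action [E, s |-> s @: E] of permutations on sets, so that
   [s] sends A_(i,j) to A_(s i, s j). *)
Definition orbitA (n : nat) (theta : 'S_n) (E : {set 'I_n}) :
    {set {set 'I_n}} :=
  orbit 'P^* <[theta]> E.

Definition transversalA (n : nat) (theta : 'S_n) (T : {set {set 'I_n}}) : bool :=
  is_transversal T [set orbitA theta E | E in basisA n] (basisA n).

Definition exponent_on (n : nat) (T : {set {set 'I_n}})
    (z : {set 'I_n} -> int) (E : {set 'I_n}) : int :=
  if E \in T then z E else 0%R.

Definition conjugated (G : groupType) (x y : G) : Prop :=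
  exists g : G, g * x * g^-1 = y.

(* Main.v *)
From HB Require Import structures.
Require Import Defs.
From mathcomp Require Import all_boot all_order all_algebra all_fingroup.
From mathcomp Require Import generic_quotient boolp zify.
Set Implicit Arguments.
Unset Strict Implicit.
Unset Printing Implicit Defensive.
Local Open Scope group_scope.

(** Write G for the quotient of the braid group by [P_n, P_n], and A^v for the
    product of the A_E with exponents v E, where E runs over the 2-element
    sets of strands.

    The proof rests on three facts about G: the kernel of [sigma_bar] consists
    of the products A^c ([pure_prodA]); such a product determines c on
    2-element sets ([prodA_inj]); and conjugation by g permutes the A_E
    through the permutation of g ([prodA_conj]).

    The first one is the classical presentation of the symmetric group in
    disguise.  The A_(i,j) are permuted under conjugation by the generators,
    up to commutators of pure braids ([pure_gen_conj_closed]), so they generate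
    a normal subgroup N containing the squares of the generators.  Modulo N
    the generators are involutions with the braid relations, and a coset
    enumeration ([parabolicS]) peels off one strand at a time, which shows
    that only N is killed by [sigma_bar] ([perm_ker]).

    For the other two, let [crossing] send a braid to its permutation together
    with, for each pair of strands, the signed number of their crossings.  It
    is a homomorphism from G to the semidirect product of Z^(sets of strands)
    by S_n, and it sends A_E to twice the basis vector of E
    ([crossing_prodA]).  Hence the A_E are independent, and with the first
    fact [crossing] is injective ([crossing_inj]).  Identities in G can then be
    checked in the semidirect product, where the conjugation formula is
    immediate.

    Now let g in G have permutation C commuting with theta, and let c be given
    by g beta g^-1 = beta A^c.  Then g conjugates beta A^z to beta A^v, where
    v E = c E + z (C E) ([conj_twisted]).  Taking g := A^a with a arbitrary, it
    replaces v by v + a o theta - a ([conj_prodA]).  A function is of the form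
    a o theta - a exactly when its sums over theta-orbits vanish
    ([coboundary_of_orbit_sums] is the existence part), so the beta A^v up to
    conjugation by pure elements are classified by the orbit sums of v.  For
    exponents supported on a transversal these sums are the exponents
    themselves, and comparing them gives the stated conditions
    ([orbit_conditions]). *)

(** * Conjugates of the pure generators by the braid generators *)

Section BraidWords.
Variables (G : groupType) (s : nat -> G).

Definition descend a b : G := \prod_(k <- rev (index_iota a b)) s k.

Lemma descend_id a : descend a a = 1.
Proof. by rewrite /descend /index_iota subnn big_nil. Qed.

Lemma descend_cat a c b :
  a <= c -> c <= b -> descend a b = descend c b * descend a c.
Proof.
move=> ac cb; rewrite /descend -big_cat -rev_cat /index_iota.
by congr (\prod_(k <- rev _) s k); rewrite -{2}(subnKC ac) -iotaD; congr iota; lia.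
Qed.

Lemma descend1 a : descend a a.+1 = s a.
Proof. by rewrite /descend /index_iota subSnn big_seq1. Qed.

Lemma descendSr a b : a <= b -> descend a b.+1 = s b * descend a b.
Proof. by move=> ab; rewrite (descend_cat ab (leqnSn b)) descend1. Qed.

Lemma descendSl a b : a < b -> descend a b = descend a.+1 b * s a.
Proof. by move=> ab; rewrite (descend_cat (leqnSn a) ab) descend1. Qed.

Lemma commute_descend x a b :
  (forall k, a <= k < b -> commute x (s k)) -> commute x (descend a b).
Proof.
move=> xs; rewrite /descend big_seq; apply: commute_prod => k.
by rewrite mem_rev mem_index_iota; apply: xs.
Qed.

Definition pure_gen i j : G := (s i ^+ 2) ^ (descend i.+1 j)^-1.

Variable m : nat.
Hypothesis far_commute : forall k l, k.+1 < l -> commute (s k) (s l).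
Hypothesis braid_relation :
  forall k, k.+1 < m -> s k * s k.+1 * s k = s k.+1 * s k * s k.+1.

(** The identity s_l (s_(l+1) s_l) = (s_(l+1) s_l) s_(l+1) inside the descending
    word; the factors on either side commute with s_l, resp. s_(l+1). *)
Lemma descend_shift a b l : a <= l -> l.+1 < b -> b <= m ->
  s l * descend a b = descend a b * s l.+1.
Proof.
move=> al lb bm.
rewrite (@descend_cat a l b) ?(@descend_cat l l.+2 b) //; try lia.
rewrite descendSr // descend1 -!mulgA.
have -> : descend a l * s l.+1 = s l.+1 * descend a l.
  apply: commute_sym; apply: commute_descend => k kl.
  by apply/commute_sym/far_commute; lia.
have sD : commute (s l) (descend l.+2 b).
  by apply: commute_descend => k kl; apply: far_commute; lia.
rewrite [LHS]mulgA sD -!mulgA; congr (_ * _).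
by rewrite !mulgA braid_relation //; lia.
Qed.

Lemma conj_fix (x y : G) : commute x y -> x ^ y^-1 = x.
Proof. by move=> xy; apply/conjg_fixP/commgP/commuteV. Qed.

Lemma pure_gen_conj i j k :
  pure_gen i j ^ (s k)^-1 = (s i ^+ 2) ^ (s k * descend i.+1 j)^-1.
Proof. by rewrite /pure_gen -conjgM -invgM. Qed.

Lemma pure_gen_fix_outside i j k : k.+1 < i \/ i < j < k ->
  pure_gen i j ^ (s k)^-1 = pure_gen i j.
Proof.
move=> ijk; apply: conj_fix; rewrite /pure_gen conjgE invgK.
have sC l : i <= l -> (l < j) || (l == i) -> commute (s k) (s l).
  move=> il lj; have [kl|kl] : k.+1 < l \/ l.+1 < k by lia.
    exact: far_commute.
  exact/commute_sym/far_commute.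
have sD : commute (s k) (descend i.+1 j).
  by apply: commute_descend => l ?; apply: sC; lia.
apply: commute_sym; apply: commuteM => //; apply: commuteM; last exact: commuteV.
by apply: commuteX; apply: sC; rewrite ?eqxx ?orbT.
Qed.

(** Moving s_k through the descending word turns it into s_(k+1), which is far
    from s_i. *)
Lemma pure_gen_fix_inside i j k : i < k -> k.+1 < j -> j <= m ->
  pure_gen i j ^ (s k)^-1 = pure_gen i j.
Proof.
move=> ik kj jm; rewrite pure_gen_conj descend_shift // invgM conjgM.
rewrite [_ ^ (s k.+1)^-1]conj_fix //.
exact/commute_sym/commuteX/commute_sym/far_commute.
Qed.

Lemma pure_gen_fix_adjacent i : pure_gen i i.+1 ^ (s i)^-1 = pure_gen i i.+1.
Proof.
by rewrite /pure_gen descend_id invg1 conjg1 conj_fix //; apply/commute_sym/commuteX.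
Qed.

Lemma pure_gen_raise_right i j : i < j -> pure_gen i j ^ (s j)^-1 = pure_gen i j.+1.
Proof. by move=> ij; rewrite pure_gen_conj -descendSr. Qed.

(** Everything reduces to s_i s_(i+1) conjugating s_i to s_(i+1), a rewriting of
    the braid relation. *)
Lemma pure_gen_raise_left i j : i.+1 < j -> j <= m ->
  pure_gen i j ^ (s i)^-1 = pure_gen i.+1 j.
Proof.
move=> ij jm; rewrite pure_gen_conj descendSl // mulgA.
have -> : s i * descend i.+2 j = descend i.+2 j * s i.
  by apply: commute_descend => k ki; apply: far_commute; lia.
rewrite -mulgA invgM conjgM conjXg.
have -> // : s i ^ (s i * s i.+1)^-1 = s i.+1.
rewrite conjgE invgK mulgA braid_relation; last lia.
by rewrite -[s i.+1 * _ * _]mulgA mulgK.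
Qed.

(* This is how commutativity of pure braids enters: s_k ^+ 2 and [pure_gen i j]
   both lie in the kernel of the map to the symmetric group. *)
Hypothesis sq_commute :
  forall k i j, i < j <= m -> commute (s k ^+ 2) (pure_gen i j).

(** The cases in which s_k lowers an index are inverse to the raising ones:
    conjugating by s_k twice is trivial, as s_k ^+ 2 commutes with every
    [pure_gen]. *)
Lemma pure_gen_conj_closed i j k : i < j <= m -> k < m ->
  exists i' j', i' < j' <= m /\ pure_gen i j ^ (s k)^-1 = pure_gen i' j'.
Proof.
move=> /andP[ij jm] km.
have back x y : commute (s k ^+ 2) x -> x ^ (s k)^-1 = y -> y ^ (s k)^-1 = x.
  by move=> xC <-; rewrite -conjgM -invgM -expg2 conj_fix //; apply: commute_sym.
have [ki|[ki|[ik|[ik|[ik|[ik|[ik|ik]]]]]]] :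
  (k.+1 < i) \/ (i = k.+1) \/ (k = i /\ j = i.+1) \/ (k = i /\ i.+1 < j) \/
  (i < k /\ k.+1 < j) \/ (i < k /\ j = k.+1) \/ k = j \/ j < k by lia.
- by exists i, j; rewrite pure_gen_fix_outside ?ij ?jm; auto.
- exists k, j; split; first lia; subst i.
  by apply: back; [apply: sq_commute; lia | apply: pure_gen_raise_left].
- by exists i, j; case: ik => -> ->; rewrite pure_gen_fix_adjacent; split=> //; lia.
- by exists i.+1, j; case: ik => -> ij'; rewrite pure_gen_raise_left //; split=> //; lia.
- by exists i, j; case: ik => ik kj; rewrite pure_gen_fix_inside // ij jm.
- case: ik => ik ?; subst j; exists i, k; split; first lia.
  by apply: back; [apply: sq_commute; lia | apply: pure_gen_raise_right].
- by exists i, j.+1; subst k; rewrite pure_gen_raise_right //; split=> //; lia.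
- by exists i, j; rewrite pure_gen_fix_outside ?ij ?jm; auto.
Qed.

End BraidWords.

(** * The kernel of the map to the symmetric group *)

Section KernelOfPermutation.
Variables (n : nat) (G : groupType) (s : nat -> G) (f : UMagmaMorphism.type G 'S_n).
Hypothesis f_gen : forall k : 'I_n.-1, f (s k) = tperm (ord_low k) (ord_high k).

Lemma perm_gen_val k (x : 'I_n) : k < n.-1 ->
  f (s k) x = (if x == k :> nat then k.+1 else if x == k.+1 :> nat then k else x) :> nat.
Proof.
move=> kn; rewrite (f_gen (Ordinal kn)).
case: tpermP => [->|->|/eqP + /eqP]; rewrite /= ?eqxx //.
  by rewrite (gtn_eqF (ltnSn k)).
by rewrite -!val_eqE /= => /negPf-> /negPf->.
Qed.

Lemma perm_descend_last a b (x : 'I_n) : a <= b -> x = b :> nat ->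
  f (descend s a b) x = a :> nat.
Proof.
elim: b x => [|b IHb] x.
  by rewrite leqn0 => /eqP->; rewrite descend_id gmulf1 perm1.
rewrite leq_eqVlt => /predU1P[-> xb|ab xb]; first by rewrite descend_id gmulf1 perm1.
rewrite descendSr // gmulfM permM IHb // perm_gen_val; last by have := ltn_ord x; lia.
by rewrite xb eqxx gtn_eqF.
Qed.

Lemma perm_descend_below a b (x : 'I_n) : x < a -> a <= b -> b < n ->
  f (descend s a b) x = x.
Proof.
move=> xa ab bn; elim: b ab bn => [|b IHb]; first by move: xa; lia.
rewrite leq_eqVlt => /predU1P[-> _|ab bn]; first by rewrite descend_id gmulf1 perm1.
rewrite descendSr // gmulfM permM.
have -> : f (s b) x = x.
  apply: val_inj => /=; rewrite perm_gen_val; last lia.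
  by rewrite !ltn_eqF //; lia.
by rewrite IHb //; lia.
Qed.

Hypothesis far_commute : forall k l, k.+1 < l -> commute (s k) (s l).
Hypothesis braid_relation :
  forall k, k.+1 < n.-1 -> s k * s k.+1 * s k = s k.+1 * s k * s k.+1.
Hypothesis gen_generate :
  forall x, Defs.generated (fun y => exists2 k, k < n.-1 & y = s k) x.
Variable N : G -> Prop.
Hypotheses (N1 : N 1) (NM : forall x y, N x -> N y -> N (x * y)).
Hypothesis NV : forall x, N x -> N x^-1.
Hypothesis NJ : forall x g, N x -> N (x ^ g).
Hypothesis N_sq : forall k, k < n.-1 -> N (s k ^+ 2).
Hypothesis N_ker : forall x, N x -> f x = 1.

(** The analogue modulo N of the standard parabolic subgroup on the strands
    0, ..., c.  Including N among the generators avoids forming the quotient by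
    N. *)
Definition parabolic c := Defs.generated (fun y => N y \/ exists2 k, k < c & y = s k).

Lemma parabolicN c x : N x -> parabolic c x.
Proof. by move=> Nx; apply: gen_mem; left. Qed.

Lemma parabolic_gen c k : k < c -> parabolic c (s k).
Proof. by move=> kc; apply: gen_mem; right; exists k. Qed.

Lemma parabolic0 x : parabolic 0 x -> N x.
Proof. by elim=> {x} [x [|[]]|||] //; auto. Qed.

Lemma parabolic_perm c x (i : 'I_n) : c < n -> parabolic c x -> c < i -> f x i = i.
Proof.
move=> cn + ci; elim=> {x} [x [/N_ker->|[k kc ->]]||x y _ Hx _ Hy|x _ Hx].
- by rewrite perm1.
- by apply: val_inj => /=; rewrite perm_gen_val ?gtn_eqF //; lia.
- by rewrite gmulf1 perm1.
- by rewrite gmulfM permM Hx Hy.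
- by rewrite gmulfV -{1}Hx permK.
Qed.

(** The descending words s_c ... s_k with k <= c.+1, empty for k = c.+1, are the
    minimal right coset representatives of S_(c+1) in S_(c+2). *)
Definition coset_form c x := exists k y,
  [/\ k <= c.+1, parabolic c y & x = y * descend s k c.+1].

Lemma coset_formN c x g : N g -> coset_form c x -> coset_form c (x * g).
Proof.
move=> Ng [k [y [kc Py ->]]].
exists k, (y * g ^ (descend s k c.+1)^-1); split=> //.
  by apply: gen_mul => //; apply/parabolicN/NJ.
by rewrite conjgE invgK !mulgA mulgVK.
Qed.

(** Right multiplication by s_l permutes the c.+2 cosets: it extends the word,
    shortens it up to a square, or passes through it to become a generator of
    the smaller parabolic subgroup. *)
Lemma coset_form_gen c x l : c < n.-1 -> l <= c ->
  coset_form c x -> coset_form c (x * s l).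
Proof.
move=> cn lc [k [y [kc Py ->]]].
have [lk|[lk|[lk|lk]]] : l.+1 < k \/ k = l.+1 \/ k = l \/ k < l by lia.
- exists k, (y * s l); split=> //.
    by apply: gen_mul => //; apply: parabolic_gen; lia.
  rewrite -!mulgA; congr (_ * _); apply/commute_sym/commute_descend => i ik.
  by apply: far_commute; lia.
- exists l, y; split=> //; first lia.
  by rewrite lk -mulgA -descendSl //; lia.
- subst k; rewrite descendSl // -!mulgA -expg2 mulgA.
  apply: coset_formN; first by apply: N_sq; lia.
  by exists l.+1, y.
- case: l lc lk => [|l] lc lk; first lia.
  exists k, (y * s l); split=> //.
    by apply: gen_mul => //; apply: parabolic_gen; lia.
  by rewrite -!mulgA; congr (_ * _); rewrite (descend_shift far_commute braid_relation).
Qed.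

(** The induction treats a factor and its inverse together, because stability
    of the set of cosets under x does not formally give stability under x^-1. *)
Lemma parabolicS c x : c < n.-1 -> parabolic c.+1 x -> coset_form c x.
Proof.
move=> cn Px; rewrite -[x]mul1g.
have form1 : coset_form c 1.
  by exists c.+1, 1; rewrite descend_id mulg1; split=> //; apply: gen_one.
suff: forall y, coset_form c y -> coset_form c (y * x) /\ coset_form c (y * x^-1).
  by case/(_ 1 form1).
elim: {x}Px => [x [Nx|[k kc ->]]||x x' _ Hx _ Hx'|x _ Hx] y Fy.
- by split; apply: coset_formN => //; apply: NV.
- split; first by apply: coset_form_gen; rewrite -1?ltnS.
  have -> : y * (s k)^-1 = y * (s k ^+ 2)^-1 * s k.
    by rewrite expg2 invgM !mulgA mulgVK.
  apply: coset_form_gen; rewrite -1?ltnS //.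
  by apply: coset_formN => //; apply/NV/N_sq; lia.
- by rewrite invg1 mulg1.
- split; first by rewrite mulgA; apply: (Hx' _ (Hx _ Fy).1).1.
  by rewrite invgM mulgA; apply: (Hx _ (Hx' _ Fy).2).2.
- by rewrite invgK; split; apply Hx.
Qed.

(** In a coset form y * (s_c ... s_k), y fixes strand c.+1 and the word sends it
    to k; if the product has trivial permutation then k = c.+1, the word is
    empty and the element already lies in the smaller parabolic subgroup. *)
Lemma parabolic_ker c x : c <= n.-1 -> parabolic c x -> f x = 1 -> N x.
Proof.
elim: c x => [x _ /parabolic0 //|c IHc] x cn Px fx1.
have [k [y [kc Py xE]]] := parabolicS cn Px.
have cn' : c.+1 < n by lia.
have fd : f (descend s k c.+1) (Ordinal cn') = Ordinal cn'.
  rewrite -[in RHS](perm1 (Ordinal cn')) -fx1 xE gmulfM permM.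
  by rewrite (parabolic_perm _ Py) //; lia.
have kE : k = c.+1 by rewrite -(perm_descend_last (x := Ordinal cn') kc erefl) fd.
by apply: IHc; rewrite ?(ltnW cn) // xE kE descend_id mulg1.
Qed.

Lemma perm_ker x : f x = 1 -> N x.
Proof.
apply: (@parabolic_ker n.-1) => //; elim: (gen_generate x) => {x}.
- by move=> x [k kn ->]; apply: parabolic_gen.
- exact: gen_one.
- by move=> x y _ + _; apply: gen_mul.
- by move=> x _; apply: gen_inv.
Qed.

End KernelOfPermutation.

(** * Counting crossings *)

Lemma imset_permM (T : finType) (s t : {perm T}) (E : {set T}) :
  (s * t) @: E = t @: (s @: E).
Proof. by rewrite -imset_comp; apply: eq_imset => x; rewrite permM. Qed.

Lemma imset_perm_eq_set2 (T : finType) (s : {perm T}) (E : {set T}) a b :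
  (s @: E == [set a; b]) = (E == [set s^-1 a; s^-1 b]).
Proof.
apply/eqP/eqP => [sE|->]; last by rewrite imsetU1 imset_set1 !permKV.
by rewrite -[LHS](imset_perm1 E) -(mulgV s) imset_permM sE imsetU1 imset_set1.
Qed.

Section CrossingGroup.
Variable n : nat.

(** The semidirect product of the integer functions on sets of strands by S_n.
    All sets are allowed as indices, so that S_n acts on a plain function type;
    only 2-element sets ever carry crossings. *)
Definition crossing_group := ({ffun {set 'I_n} -> int} * {perm 'I_n})%type.
Implicit Types u v : crossing_group.

HB.instance Definition _ := Choice.on crossing_group.

(** The pair of strands that start at E in u * v continues at u.2 @: E when v
    begins. *)
Definition crossing_mul u v : crossing_group :=
  ([ffun E : {set 'I_n} => u.1 E + v.1 (u.2 @: E)]%R, u.2 * v.2).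
Definition crossing_one : crossing_group := (0%R, 1).
Definition crossing_inv u : crossing_group :=
  ([ffun E : {set 'I_n} => - u.1 (u.2^-1%g @: E)]%R, u.2^-1).

Lemma crossing_mulA : associative crossing_mul.
Proof.
move=> u v w; congr pair; last exact: mulgA.
by apply/ffunP=> E; rewrite !ffunE /= GRing.addrA imset_permM.
Qed.

Lemma crossing_mul1g : left_id crossing_one crossing_mul.
Proof.
case=> v s; congr pair; last exact: mul1g.
by apply/ffunP=> E; rewrite !ffunE /= GRing.add0r imset_perm1.
Qed.

Lemma crossing_mulg1 : right_id crossing_one crossing_mul.
Proof.
case=> v s; congr pair; last exact: mulg1.
by apply/ffunP=> E; rewrite !ffunE /= GRing.addr0.
Qed.

Lemma crossing_mulVg : left_inverse crossing_one crossing_inv crossing_mul.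
Proof.
move=> u; congr pair; last exact: mulVg.
by apply/ffunP=> E; rewrite !ffunE /= GRing.addNr.
Qed.

Lemma crossing_mulgV : right_inverse crossing_one crossing_inv crossing_mul.
Proof.
move=> u; congr pair; last exact: mulgV.
by apply/ffunP=> E; rewrite !ffunE /= -imset_permM mulgV imset_perm1 GRing.addrN.
Qed.

HB.instance Definition _ := isGroup.Build crossing_group
  crossing_mulA crossing_mul1g crossing_mulg1 crossing_mulVg crossing_mulgV.

Lemma crossingM1 u v E : (u * v).1 E = (u.1 E + v.1 (u.2 @: E))%R.
Proof. by rewrite ffunE. Qed.

Lemma crossingM2 u v : (u * v).2 = u.2 * v.2. Proof. by []. Qed.
Lemma crossingV2 u : (u^-1).2 = u.2^-1. Proof. by []. Qed.

Lemma crossingV1 u E : (u^-1).1 E = (- u.1 (u.2^-1%g @: E))%R.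
Proof. by rewrite ffunE. Qed.

Lemma crossing_eq u v : u.1 =1 v.1 -> u.2 = v.2 -> u = v.
Proof. by case: u v => [u s] [v t] /= /ffunP-> ->. Qed.

Lemma crossing_conj (v : {ffun {set 'I_n} -> int}) u :
  u * (v, 1) * u^-1 = ([ffun E : {set 'I_n} => v (u.2 @: E)], 1) :> crossing_group.
Proof.
apply: crossing_eq => [E|]; last by rewrite !crossingM2 crossingV2 mulg1 mulgV.
rewrite !crossingM1 crossingV1 crossingM2 mulg1 -imset_permM mulgV imset_perm1 ffunE.
by rewrite GRing.addrAC GRing.addrN GRing.add0r.
Qed.

Definition crossing_gen (k : 'I_n.-1) : crossing_group :=
  ([ffun E : {set 'I_n} => (E == [set ord_low k; ord_high k])%:R]%R,
   tperm (ord_low k) (ord_high k)).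

Lemma crossing_word_perm w :
  (word_eval crossing_gen w).2 =
  word_eval (fun k => tperm (ord_low k) (ord_high k) : 'S_n) w.
Proof.
elim: w => [|[k e] w IHw]; first by rewrite /word_eval !big_nil.
rewrite -cat1s !word_evalM crossingM2 IHw; congr (_ * _).
by rewrite /word_eval !big_seq1; case: e.
Qed.

(** On both sides of a braid relation each of the three pairs of strands crosses
    exactly once. *)
Lemma crossing_rel w w' : braid_rel w w' ->
  word_eval crossing_gen w = word_eval crossing_gen w'.
Proof.
move=> ww'; apply: crossing_eq => [E|]; last first.
  by rewrite !crossing_word_perm (braid_perm_rel ww').
case: ww' => i j ij;
  rewrite /word_eval !big_cons !big_nil !mulg1 !crossingM1 !ffunE /=;
  rewrite !imset_perm_eq_set2 ?tpermV.
- have -> : ord_low j = ord_high i by apply: val_inj.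
  set a := ord_low i; set b := ord_high i; set c := ord_high j.
  have ab : a != b by rewrite -val_eqE /= neq_ltn ltnSn.
  have ac : a != c by rewrite -val_eqE /= ij neq_ltn ltnS leqnSn.
  have bc : b != c by rewrite -val_eqE /= ij neq_ltn ltnSn.
  have [ba ca] : b != a /\ c != a by rewrite !(eq_sym _ a).
  rewrite !(tpermL, tpermR, tpermD ac bc, tpermD ba ca).
  by rewrite !GRing.addrA GRing.addrC GRing.addrA GRing.addrAC.
- have disj (k l : 'I_n.-1) x :
    x = ord_low l \/ x = ord_high l -> (k.+1 < l) || (l.+1 < k) ->
    tperm (ord_low k) (ord_high k) x = x.
    by move=> xl kl; rewrite tpermD // -val_eqE /=; case: xl => -> /=; lia.
  rewrite !(disj i j) ?ij ?(disj j i) ?ij ?orbT; auto.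
  by rewrite GRing.addrC.
Qed.

Definition braid_crossing (x : braid n) : crossing_group :=
  pres_lift crossing_gen x.

Lemma braid_crossing_morphism : monoid_morphism braid_crossing.
Proof. exact: pres_lift_morphism crossing_rel. Qed.

HB.instance Definition _ := isUMagmaMorphism.Build (braid n) crossing_group
  braid_crossing braid_crossing_morphism.

Lemma braid_crossing_gen k :
  braid_crossing (pres_gen (@braid_rel n) k) = crossing_gen k.
Proof. exact: pres_lift_gen crossing_rel k. Qed.

Lemma braid_crossing_perm x : (braid_crossing x).2 = braid_perm x.
Proof. exact: crossing_word_perm. Qed.

Lemma crossing_pure_commute u v : u.2 = 1 -> v.2 = 1 -> commute u v.
Proof.
move=> u1 v1; apply: crossing_eq => [E|]; last by rewrite !crossingM2 u1 v1.
by rewrite !crossingM1 u1 v1 !imset_perm1 GRing.addrC.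
Qed.

(** Pure braids land in the abelian normal subgroup of the semidirect product. *)
Lemma braid_crossing_pure_comm x : x \in pure_comm n -> braid_crossing x = 1.
Proof.
move=> /asboolP; elim=> {x} [x [a [b [/eqP Ha /eqP Hb ->]]]||x y _ Hx _ Hy|x _ Hx].
- rewrite gmulfR; apply/eqP/commgP.
  by apply: crossing_pure_commute; rewrite /= braid_crossing_perm.
- exact: gmulf1.
- by rewrite gmulfM /= Hx Hy mulg1.
- by rewrite gmulfV /= Hx invg1.
Qed.

Definition crossing (x : braid_ab n) : crossing_group := braid_crossing (repr x).

Lemma crossing_proj (x : braid n) :
  crossing (quot_proj (pure_comm n) x) = braid_crossing x.
Proof.
have /braid_crossing_pure_comm := quot_reprP (pure_comm n) x.
by rewrite gmulfM gmulfV => /(canRL (mulKVg _)); rewrite mulg1.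
Qed.

Lemma crossing_morphism : monoid_morphism crossing.
Proof.
split=> [|x y]; first by rewrite crossing_proj gmulf1.
by rewrite crossing_proj gmulfM.
Qed.

HB.instance Definition _ := isUMagmaMorphism.Build (braid_ab n) crossing_group
  crossing crossing_morphism.

Lemma crossing_perm x : (crossing x).2 = sigma_bar x.
Proof. exact: braid_crossing_perm. Qed.

End CrossingGroup.

(** * Integer powers *)

Section IntegerPowers.
Variable G : groupType.
Implicit Types x : G.

Lemma expgz_succ x (k : int) : expgz x (k + 1)%R = expgz x k * x.
Proof.
case: k => k; first by rewrite -PoszD addn1 /= expgSr.
rewrite NegzE; case: k => [|k]; first by rewrite GRing.addNr /= expg1 mulVg.
have -> : (- k.+2%:Z + 1 = Negz k)%R by rewrite NegzE; lia.
by rewrite -NegzE /= [x ^+ k.+2]expgS invgM mulgVK.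
Qed.

Lemma expgz_add x (k l : int) : expgz x (k + l)%R = expgz x k * expgz x l.
Proof.
elim/int_rect: l => [|l IHl|l IHl]; first by rewrite GRing.addr0 /= mulg1.
  by rewrite -addn1 PoszD GRing.addrA !expgz_succ IHl mulgA.
apply: (mulIg x); rewrite -mulgA -!expgz_succ.
have -> : (- l.+1%:Z + 1 = - l%:Z)%R by lia.
by rewrite -IHl; congr expgz; lia.
Qed.

Lemma commute_expgz x y k : commute x y -> commute x (expgz y k).
Proof. by move=> xy; case: k => k; [|apply: commuteV]; apply: commuteX. Qed.

End IntegerPowers.

Lemma gmulf_expgz (G H : groupType) (f : UMagmaMorphism.type G H) x k :
  f (expgz x k) = expgz (f x) k.
Proof. by case: k => k; rewrite /expgz ?gmulfXVn ?gmulfXn. Qed.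

Section PureCrossings.
Variable n : nat.

Definition pure_crossing (u : {ffun {set 'I_n} -> int}) : crossing_group n := (u, 1).

Lemma pure_crossingD u v :
  pure_crossing (u + v)%R = pure_crossing u * pure_crossing v.
Proof.
apply: crossing_eq => [E|]; last by rewrite crossingM2 mulg1.
by rewrite crossingM1 imset_perm1 ffunE.
Qed.

Lemma pure_crossing_prod I r (P : pred I) u :
  \prod_(i <- r | P i) pure_crossing (u i) = pure_crossing (\sum_(i <- r | P i) u i)%R.
Proof. by rewrite (big_morph _ pure_crossingD erefl). Qed.

Lemma pure_crossing_expgz u k :
  expgz (pure_crossing u) k = pure_crossing [ffun E => u E * k]%R.
Proof.
have E0 : pure_crossing [ffun E => u E * 0]%R = 1.
  by congr pair; apply/ffunP=> E; rewrite !ffunE GRing.mulr0.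
have ES l : pure_crossing [ffun E => u E * (l + 1)]%R =
    pure_crossing [ffun E => u E * l]%R * pure_crossing u.
  rewrite -pure_crossingD; congr pure_crossing; apply/ffunP=> E.
  by rewrite !ffunE GRing.mulrDr GRing.mulr1.
elim/int_rect: k => [|k IHk|k IHk]; first by rewrite E0.
  by rewrite -addn1 PoszD expgz_succ IHk ES.
apply: (mulIg (pure_crossing u)); rewrite -ES -expgz_succ.
by have -> : (- k.+1%:Z + 1 = - k%:Z)%R by lia.
Qed.

End PureCrossings.


(** * The free abelian kernel and the conjugation formula *)

Lemma pres_pi_cat (I : choiceType) (R : word I -> word I -> Prop) (u v : word I) :
  \pi_(pres_group R)%qT (u ++ v) = \pi_(pres_group R)%qT u * \pi_(pres_group R)%qT v.
Proof. by apply/esym/pres_piP/pres_cat; apply: pres_reprP. Qed.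

Lemma pres_gen2 (I : choiceType) (R : word I -> word I -> Prop) i j :
  pres_gen R i * pres_gen R j = \pi_(pres_group R)%qT [:: (i, true); (j, true)].
Proof. by rewrite /pres_gen -pres_pi_cat. Qed.

Lemma pres_gen_ind (I : choiceType) (R : word I -> word I -> Prop) (x : pres_group R) :
  Defs.generated (fun y => exists i, y = pres_gen R i) x.
Proof.
rewrite -[x]reprK; elim: (repr x) => [|[i e] w IHw]; first exact: gen_one.
rewrite -cat1s pres_pi_cat; apply: gen_mul => //.
have gen_i : Defs.generated (fun y => exists i, y = pres_gen R i) (pres_gen R i).
  by apply: gen_mem; exists i.
case: e => //; suff -> : \pi_(pres_group R)%qT [:: (i, false)] = (pres_gen R i)^-1.
  exact: gen_inv.
apply/esym/mulg1_eq; rewrite /pres_gen -pres_pi_cat.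
exact/pres_piP/pres_cancel.
Qed.

Section BraidAb.
Variable n : nat.
Implicit Types (x y g : braid_ab n) (E : {set 'I_n}).

Definition ab_gen k : braid_ab n := quot_proj (pure_comm n) (braid_gen n k).

Lemma braid_gen_ord (k : 'I_n.-1) : braid_gen n k = pres_gen (@braid_rel n) k.
Proof. by rewrite /braid_gen valK. Qed.

Lemma braid_gen_big k : n.-1 <= k -> braid_gen n k = 1.
Proof. by move=> nk; rewrite /braid_gen insubN // -leqNgt. Qed.

Lemma ab_gen_far k l : k.+1 < l -> commute (ab_gen k) (ab_gen l).
Proof.
move=> kl; apply: gmulf_commute.
have [ln|/braid_gen_big->] := ltnP l n.-1; last exact: commute1.
have kn : k < n.-1 by lia.
rewrite /commute (braid_gen_ord (Ordinal kn)) (braid_gen_ord (Ordinal ln)).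
by rewrite /pres_gen -!pres_pi_cat; apply/pres_piP/pres_rel/braid_rel_comm.
Qed.

Lemma ab_gen_braid k : k.+1 < n.-1 ->
  ab_gen k * ab_gen k.+1 * ab_gen k = ab_gen k.+1 * ab_gen k * ab_gen k.+1.
Proof.
move=> kn.
have := congr1 (quot_proj (pure_comm n)) (_ : braid_gen n k * braid_gen n k.+1 *
  braid_gen n k = braid_gen n k.+1 * braid_gen n k * braid_gen n k.+1).
rewrite !gmulfM; apply.
rewrite (braid_gen_ord (Ordinal kn)) (braid_gen_ord (Ordinal (ltnW kn))).
rewrite !pres_gen2 /pres_gen -!pres_pi_cat.
by apply/pres_piP/pres_rel; apply: braid_rel_braid.
Qed.

Lemma ab_gen_generate x :
  Defs.generated (fun y => exists2 k, k < n.-1 & y = ab_gen k) x.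
Proof.
rewrite -(quot_reprK x).
elim: (pres_gen_ind (repr x)) => {x} [_ [i ->]||x y _ IHx _ IHy|x _ IHx].
- by apply: gen_mem; exists i => //; rewrite /ab_gen braid_gen_ord.
- by rewrite gmulf1; apply: gen_one.
- by rewrite gmulfM; apply: gen_mul.
- by rewrite gmulfV; apply: gen_inv.
Qed.

Lemma Aij_pure_gen (i j : 'I_n) : Aij i j = pure_gen ab_gen i j.
Proof.
rewrite /Aij /braidA /pure_gen gmulfM gmulfV gmulfM gmulfXn conjgE invgK mulgA.
by rewrite !gmulf_prod /descend ?expg2 !mulgA.
Qed.

Lemma crossing_ab_gen (k : 'I_n.-1) : crossing (ab_gen k) = crossing_gen k.
Proof. by rewrite crossing_proj braid_gen_ord braid_crossing_gen. Qed.

Lemma sigma_bar_ab_gen (k : 'I_n.-1) :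
  sigma_bar (ab_gen k) = tperm (ord_low k) (ord_high k).
Proof. by rewrite -crossing_perm crossing_ab_gen. Qed.

(** The descending word carries strand j to i.+1 next to strand i, which it
    leaves in place; there the square makes the two strands cross twice. *)
Lemma crossing_pure_gen (i j : 'I_n) : i < j ->
  crossing (pure_gen ab_gen i j) = pure_crossing [ffun E => (E == [set i; j])%:R *+ 2]%R.
Proof.
move=> ij; have jn := ltn_ord j; have im : i < n.-1 by lia.
pose k : 'I_n.-1 := Ordinal im.
rewrite /pure_gen gmulfJ gmulfXn gmulfV /= (crossing_ab_gen k).
have -> : crossing_gen k ^+ 2 =
    pure_crossing [ffun E => (E == [set ord_low k; ord_high k])%:R *+ 2]%R.
  apply: crossing_eq => [E|]; last by rewrite expg2 crossingM2 tperm2.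
  rewrite expg2 crossingM1 !ffunE imset_perm_eq_set2 tpermV tpermL tpermR.
  by rewrite [[set ord_high k; _]]setUC.
rewrite conjgE invgK mulgA crossing_conj; congr pair.
apply/ffunP=> E; rewrite !ffunE crossing_perm.
have <- : sigma_bar (descend ab_gen i.+1 j) @: [set i; j] = [set ord_low k; ord_high k].
  rewrite imsetU1 imset_set1; congr [set _; _]; last first.
    by apply: val_inj; apply: (perm_descend_last sigma_bar_ab_gen).
  rewrite (perm_descend_below sigma_bar_ab_gen) //.
  exact: val_inj.
by rewrite (inj_eq (imset_inj (@perm_inj _ _))).
Qed.

Lemma pure_commute x y : sigma_bar x = 1 -> sigma_bar y = 1 -> commute x y.
Proof.
move=> /eqP x1 /eqP y1; apply/commgP/eqP.
rewrite -(quot_reprK x) -(quot_reprK y) -gmulfR /= -[RHS]/(quot_proj (pure_comm n) 1).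
apply/quot_projP; rewrite coset_eq_sym /coset_eq invg1 mul1g.
by apply/asboolP/gen_mem; exists (repr x), (repr y).
Qed.

Lemma sigma_bar_pure_gen i j : i < j <= n.-1 -> sigma_bar (pure_gen ab_gen i j) = 1.
Proof.
move=> ij; have iN : i < n.-1 by lia.
rewrite /pure_gen gmulfJ gmulfXn /= (sigma_bar_ab_gen (Ordinal iN)).
by rewrite expg2 tperm2 conj1g.
Qed.

Lemma sigma_bar_sq k : k < n.-1 -> sigma_bar (ab_gen k ^+ 2) = 1.
Proof.
by move=> kn; rewrite gmulfXn /= (sigma_bar_ab_gen (Ordinal kn)) expg2 tperm2.
Qed.

Lemma ab_gen_sq_commute k i j : i < j <= n.-1 ->
  commute (ab_gen k ^+ 2) (pure_gen ab_gen i j).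
Proof.
move=> ij; have [kn|kn] := ltnP k n.-1.
  exact/pure_commute/sigma_bar_pure_gen/ij/sigma_bar_sq.
by rewrite /ab_gen braid_gen_big // gmulf1 expg1n; apply/commute_sym/commute1.
Qed.

Definition pure_gen_subgroup : braid_ab n -> Prop :=
  Defs.generated (fun y => exists i j, i < j <= n.-1 /\ y = pure_gen ab_gen i j).

Lemma pure_gen_subgroup_pure x : pure_gen_subgroup x -> sigma_bar x = 1.
Proof.
elim=> {x} [_ [i [j [ij ->]]]||x y _ Hx _ Hy|x _ Hx].
- exact: sigma_bar_pure_gen.
- exact: gmulf1.
- by rewrite gmulfM /= Hx Hy mulg1.
- by rewrite gmulfV /= Hx invg1.
Qed.

(** Conjugations by a generator and by its inverse agree here, since the square
    of a generator commutes with all pure elements. *)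
Lemma pure_gen_subgroupJ x g : pure_gen_subgroup x -> pure_gen_subgroup (x ^ g).
Proof.
have conj_gen k y :
    k < n.-1 -> pure_gen_subgroup y -> pure_gen_subgroup (y ^ (ab_gen k)^-1).
  move=> kn; elim=> {y} [_ [i [j [ij ->]]]||y z _ Hy _ Hz|y _ Hy].
  - have [i' [j' [ij' ->]]] :=
      pure_gen_conj_closed ab_gen_far ab_gen_braid ab_gen_sq_commute ij kn.
    by apply: gen_mem; exists i', j'.
  - by rewrite conj1g; apply: gen_one.
  - by rewrite conjMg; apply: gen_mul.
  - by rewrite conjVg; apply: gen_inv.
suff: forall y, pure_gen_subgroup y ->
    pure_gen_subgroup (y ^ g) /\ pure_gen_subgroup (y ^ g^-1).
  by move=> gJ /gJ[].
elim: (ab_gen_generate g) => {x g} [_ [k kn ->]||g h _ Hg _ Hh|g _ Hg] y Hy.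
- have Hy' := conj_gen _ _ kn Hy; split=> //.
  suff -> : y ^ ab_gen k = y ^ (ab_gen k)^-1 by [].
  apply: (@conjg_inj _ (ab_gen k)^-1); rewrite conjgK -conjgM -invgM -expg2 conj_fix //.
  exact/pure_commute/sigma_bar_sq/kn/pure_gen_subgroup_pure.
- by rewrite invg1 conjg1.
- split; first by rewrite conjgM; apply: (Hh _ (Hg _ Hy).1).1.
  by rewrite invgM conjgM; apply: (Hg _ (Hh _ Hy).2).2.
- by rewrite invgK; split; apply Hg.
Qed.

Lemma pure_in_pure_gen_subgroup x : sigma_bar x = 1 -> pure_gen_subgroup x.
Proof.
apply: (@perm_ker n _ ab_gen (@sigma_bar n)) => //.
- exact: sigma_bar_ab_gen.
- exact: ab_gen_far.
- exact: ab_gen_braid.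
- exact: ab_gen_generate.
- exact: gen_one.
- exact: gen_mul.
- exact: gen_inv.
- exact: pure_gen_subgroupJ.
- move=> k kn; apply: gen_mem; exists k, k.+1; split; first lia.
  by rewrite /pure_gen descend_id invg1 conjg1.
- exact: pure_gen_subgroup_pure.
Qed.

Lemma Aij_pure (i j : 'I_n) : i < j -> sigma_bar (Aij i j) = 1.
Proof.
move=> ij; rewrite Aij_pure_gen sigma_bar_pure_gen // ij.
by have := ltn_ord j; lia.
Qed.

Lemma prodA_add u v :
  prodA (fun E : {set 'I_n} => u E + v E)%R = prodA u * prodA v.
Proof.
have AC (i j i' j' : 'I_n) k l : i < j -> i' < j' ->
    commute (expgz (Aij i j) k) (expgz (Aij i' j') l).
  move=> ij ij'; apply/commute_expgz/commute_sym/commute_expgz.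
  by apply: pure_commute; apply: Aij_pure.
rewrite /prodA -prodgM_commute.
  apply: eq_bigr => i _; rewrite -prodgM_commute; last by move=> *; apply: AC.
  by apply: eq_bigr => j _; rewrite expgz_add.
move=> i i' _ _; apply: commute_prod => j' ij'; apply: commute_sym.
by apply: commute_prod => j ij; apply: AC.
Qed.

Lemma eq_prodA u v : {in basisA n, u =1 v} -> prodA u = prodA v.
Proof.
move=> uv; apply: eq_bigr => i _; apply: eq_bigr => j ij.
by rewrite uv // inE cards2 neq_ltn ij.
Qed.

Lemma prodA0 : prodA (fun _ : {set 'I_n} => 0%R) = 1.
Proof. by rewrite /prodA big1 // => i _; rewrite big1. Qed.

Lemma set2_ltn_inj (i j i' j' : 'I_n) : i < j -> i' < j' ->
  [set i; j] = [set i'; j'] -> i = i' /\ j = j'.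
Proof.
move=> ij ij' E; have := set21 i j; have := set22 i j.
by rewrite E !inE => /orP[]/eqP ? /orP[]/eqP ?; subst => //; exfalso; lia.
Qed.

Lemma Aij_prodA (i j : 'I_n) : i < j ->
  Aij i j = prodA (fun E => (E == [set i; j])%:R%R).
Proof.
move=> ij; rewrite /prodA (big_only1 i) // => [|i' i'i _].
  rewrite (big_only1 j) // => [|j' j'j ij']; first by rewrite eqxx /= expg1.
  case: eqP => [/(set2_ltn_inj ij' ij)[_ jj]|] //.
  by rewrite jj eqxx in j'j.
rewrite big1 // => j' ij'; case: eqP => [/(set2_ltn_inj ij' ij)[ii _]|] //.
by rewrite ii eqxx in i'i.
Qed.

Lemma pure_prodA x : sigma_bar x = 1 -> exists c, x = prodA c.
Proof.
move/pure_in_pure_gen_subgroup.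
elim=> {x} [_ [i [j [/andP[ij jn] ->]]]||x y _ [c ->] _ [d ->]|x _ [c ->]].
- have jn' : j < n by lia.
  have in' : i < n by lia.
  exists (fun E => (E == [set Ordinal in'; Ordinal jn'])%:R%R).
  by rewrite -Aij_prodA // Aij_pure_gen.
- by exists (fun=> 0%R); rewrite prodA0.
- by exists (fun E => c E + d E)%R; rewrite prodA_add.
- exists (fun E => - c E)%R; apply: mulg1_eq; rewrite -prodA_add -prodA0.
  by apply: eq_prodA => E _; rewrite GRing.addrN.
Qed.

Lemma crossing_prodA c :
  crossing (prodA c) = pure_crossing [ffun E => if E \in basisA n then c E *+ 2 else 0]%R.
Proof.
rewrite /prodA gmulf_prod.
under eq_bigr => i _.
  rewrite gmulf_prod.
  under eq_bigr => j ij.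
    rewrite gmulf_expgz /= Aij_pure_gen crossing_pure_gen // pure_crossing_expgz.
    over.
  rewrite pure_crossing_prod.
  over.
rewrite pure_crossing_prod; congr pure_crossing; apply/ffunP=> E.
rewrite sum_ffunE ffunE inE; under eq_bigr do rewrite sum_ffunE.
have [/cards2P[a [b [ab ->]]]|E2] := ifPn; last first.
  rewrite big1 // => i _; rewrite big1 // => j ij; rewrite !ffunE.
  case: eqP => [EE|_]; last by rewrite GRing.mul0rn GRing.mul0r.
  by case/negP: E2; rewrite EE cards2 neq_ltn ij.
wlog ab' : a b ab / a < b.
  move=> H; have [|ba|/val_inj E'] := ltngtP a b; first exact: H.
    by rewrite setUC; apply: H; rewrite // eq_sym.
  by rewrite E' eqxx in ab.
rewrite (big_only1 a) // => [|i ia _].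
  rewrite (big_only1 b) // => [|j jb aj].
    by rewrite !ffunE eqxx GRing.mulr_natl.
  rewrite !ffunE; case: eqP => [/(set2_ltn_inj ab' aj)[_ bj]|_].
    by rewrite bj eqxx in jb.
  by rewrite GRing.mul0rn GRing.mul0r.
rewrite big1 // => j ij; rewrite !ffunE; case: eqP => [/(set2_ltn_inj ab' ij)[ai _]|_].
  by rewrite ai eqxx in ia.
by rewrite GRing.mul0rn GRing.mul0r.
Qed.

Lemma crossing_prodA_eq u v :
  crossing (prodA u) = crossing (prodA v) -> {in basisA n, u =1 v}.
Proof.
rewrite !crossing_prodA => -[/ffunP uv] E E2; have := uv E.
by rewrite !ffunE E2 => uE; lia.
Qed.

Lemma prodA_inj u v : prodA u = prodA v -> {in basisA n, u =1 v}.
Proof. by move=> uv; apply: crossing_prodA_eq; rewrite uv. Qed.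

(** The kernel of [crossing] is contained in that of [sigma_bar], hence consists
    of products of the A_E, and [crossing] reads off their exponents. *)
Lemma crossing_inj : injective (@crossing n).
Proof.
apply: gmulf_inj => x x1.
have [c xc] : exists c, x = prodA c by apply: pure_prodA; rewrite -crossing_perm x1.
rewrite xc -prodA0; apply: eq_prodA; apply: crossing_prodA_eq.
by rewrite -xc x1 prodA0 gmulf1.
Qed.

Lemma prodA_conj g v :
  g * prodA v * g^-1 = prodA (fun E => v (sigma_bar g @: E)).
Proof.
apply: crossing_inj; rewrite gmulfM gmulfM gmulfV /= !crossing_prodA crossing_conj.
congr pair; apply/ffunP=> E; rewrite !ffunE crossing_perm !inE.
by rewrite card_imset //; apply: perm_inj.
Qed.

Lemma sigma_bar_prodA v : sigma_bar (prodA v : braid_ab n) = 1.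
Proof. by rewrite -crossing_perm crossing_prodA. Qed.

Lemma prodA_onE T z : prodA_on T z = prodA (exponent_on T z) :> braid_ab n.
Proof.
apply: eq_bigr => i _; rewrite big_mkcondr /=; apply: eq_bigr => j _.
by rewrite /exponent_on; case: ifP.
Qed.

End BraidAb.

(** * Functions with vanishing orbit sums *)

Section Coboundary.
Variables (X : finType) (h : X -> X) (V : zmodType) (f : X -> V).
Hypothesis h_inj : injective h.

Lemma big_fingraph_orbit x :
  (\sum_(y in fingraph.orbit h x) f y = \sum_(i < fingraph.order h x) f (iter i h x))%R.
Proof.
rewrite -big_uniq ?orbit_uniq //= /fingraph.orbit.
elim: (fingraph.order h x) => [|k IHk]; first by rewrite big_ord0 big_nil.
by rewrite trajectSr big_rcons IHk big_ord_recr.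
Qed.

(** On each orbit choose a root r and let a be the sum of f along the path from r
    to x.  The equation can fail only where the path closes up at r, and there
    the defect is the sum of f over the orbit. *)
Lemma coboundary_of_orbit_sums :
  (forall x, \sum_(y in fingraph.orbit h x) f y = 0)%R ->
  exists a : X -> V, forall x, (a (h x) = a x + f x)%R.
Proof.
move=> f0; pose r x := froot h x.
exists (fun x => \sum_(i < findex h (r x) x) f (iter i h (r x)))%R => x.
have -> : r (h x) = r x.
  by apply/esym/eqP; rewrite (root_connect (fconnect_sym h_inj)) fconnect1.
have rx : fconnect h (r x) x by rewrite (fconnect_sym h_inj) connect_root.
move: (r x) rx => R Rx.
have [k k_lt ->] : exists2 k, k < fingraph.order h R & x = iter k h R.
  by exists (findex h R x); rewrite ?findex_max ?iter_findex.
rewrite -iterS [findex h R (iter k h R)]findex_iter //.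
have [k1|k1] := ltnP k.+1 (fingraph.order h R).
  by rewrite findex_iter // big_ord_recr.
have kE : k.+1 = fingraph.order h R by lia.
rewrite kE iter_order // findex0 big_ord0 -[LHS](f0 R) big_fingraph_orbit.
by rewrite -kE big_ord_recr.
Qed.

End Coboundary.

(** * Orbits of 2-element sets and the transversal *)

Section Orbits.
Variables (n : nat) (theta : 'S_n).
Implicit Types E F : {set 'I_n}.

Lemma imset_permX k E : (theta ^+ k) @: E = iter k (fun F => theta @: F) E.
Proof.
by elim: k => [|k IHk]; [rewrite imset_perm1 | rewrite expgSr imset_permM IHk].
Qed.

Lemma orbitAP E F : reflect (exists k, F = (theta ^+ k) @: E) (F \in orbitA theta E).
Proof.
apply: (iffP orbitP) => [[_ /cycleP[k ->] <-]|[k ->]]; first by exists k.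
by exists (theta ^+ k) => //; apply: mem_cycle.
Qed.

Lemma orbitA_fingraph E : orbitA theta E =i fingraph.orbit (fun F => theta @: F) E.
Proof.
move=> F; rewrite -fconnect_orbit; apply/orbitAP/idP => [[k ->]|EF].
  by rewrite imset_permX fconnect_iter.
by exists (findex (fun F => theta @: F) E F); rewrite imset_permX iter_findex.
Qed.

Lemma orbitA_refl E : E \in orbitA theta E.
Proof. exact: orbit_refl. Qed.

Lemma orbitA_eq E F : F \in orbitA theta E -> orbitA theta F = orbitA theta E.
Proof. by move=> /orbit_eqP. Qed.

Lemma orbitA_basis E F : F \in orbitA theta E -> (F \in basisA n) = (E \in basisA n).
Proof. by case/orbitAP => k ->; rewrite !inE card_imset //; apply: perm_inj. Qed.

Lemma orbitA_cent C E F : C \in 'C[theta] ->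
  (C @: F \in orbitA theta (C @: E)) = (F \in orbitA theta E).
Proof.
move=> /cent1P CC; have CX k : C @: ((theta ^+ k) @: E) = (theta ^+ k) @: (C @: E).
  by rewrite -!imset_permM -(commuteX k CC).
apply/orbitAP/orbitAP => -[k Fk]; exists k; last by rewrite Fk CX.
by apply: (imset_inj (@perm_inj _ C)); rewrite Fk CX.
Qed.

Lemma sum_orbitA_cent (V : zmodType) (z : {set 'I_n} -> V) C E : C \in 'C[theta] ->
  (\sum_(F in orbitA theta E) z (C @: F) = \sum_(F in orbitA theta (C @: E)) z F)%R.
Proof.
move=> CC; rewrite [RHS](reindex_inj (imset_inj (@perm_inj _ C))).
by apply: eq_bigl => F; rewrite /= orbitA_cent.
Qed.

Variable T : {set {set 'I_n}}.
Hypothesis hT : transversalA theta T.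

Lemma transversal_basis E : E \in T -> E \in basisA n.
Proof. by case/and3P: hT => _ /subsetP TB _; apply: TB. Qed.

Lemma transversal_card1 E : E \in basisA n -> #|T :&: orbitA theta E| = 1%N.
Proof.
by case/and3P: hT => _ _ /forall_inP H EB; apply/eqP/H/imset_f.
Qed.

Lemma transversal_repr E : E \in basisA n ->
  exists2 R, R \in T & orbitA theta R = orbitA theta E.
Proof.
move=> /transversal_card1/eqP/cards1P[R TR].
have /setIP[RT RE] : R \in T :&: orbitA theta E by rewrite TR set11.
by exists R => //; apply: orbitA_eq.
Qed.

Lemma sum_exponent_on z E : E \in T ->
  (\sum_(F in orbitA theta E) exponent_on T z F = z E)%R.
Proof.
move=> ET; rewrite (big_only1 E) ?orbitA_refl // => [|F FE FO].
  by rewrite /exponent_on ET.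
rewrite /exponent_on; case: ifP => // FT.
have /eqP/cards1P[R TR] := transversal_card1 (transversal_basis ET).
have /set1P ER : E \in [set R] by rewrite -TR inE ET orbitA_refl.
have /set1P FR : F \in [set R] by rewrite -TR inE FT FO.
by rewrite FR ER eqxx in FE.
Qed.

(** Case (ii) is case (i) read differently: as C commutes with theta, if C^-1 E is
    in the orbit of E then so is C E, and the orbit sum of z over the orbit of C E
    is z E. *)
Lemma orbit_conditions C (c z b : {set 'I_n} -> int) : C \in 'C[theta] ->
  (forall t q : 'I_n, [set t; q] \in T ->
          ([set C^-1 t; C^-1 q] \notin orbitA theta [set t; q] ->
             (\sum_(E in orbitA theta [set t; q]) c E
              + \sum_(E in orbitA theta [set C t; C q]) exponent_on T z E
              = b [set t; q])%R) /\
          ([set C^-1 t; C^-1 q] \in orbitA theta [set t; q] ->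
             (\sum_(E in orbitA theta [set t; q]) c E + z [set t; q]
              = b [set t; q])%R)) <->
  (forall E, E \in T ->
     \sum_(F in orbitA theta E)
        (c F + exponent_on T z (C @: F) - exponent_on T b F) = 0)%R.
Proof.
move=> CC.
have sumE E : E \in T ->
  (\sum_(F in orbitA theta E) (c F + exponent_on T z (C @: F) - exponent_on T b F) =
   \sum_(F in orbitA theta E) c F +
   \sum_(F in orbitA theta (C @: E)) exponent_on T z F - b E)%R.
  move=> ET; rewrite GRing.sumrB big_split /=.
  by rewrite (sum_orbitA_cent (exponent_on T z) E CC) (sum_exponent_on b ET).
have imC (s : 'S_n) t q : s @: [set t; q] = [set s t; s q].
  by rewrite imsetU1 imset_set1.
have fixed t q : [set t; q] \in T ->
    [set C^-1 t; C^-1 q] \in orbitA theta [set t; q] ->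
    (\sum_(F in orbitA theta (C @: [set t; q])) exponent_on T z F = z [set t; q])%R.
  move=> tqT; rewrite -imC -(orbitA_cent _ _ CC) -imset_permM mulVg imset_perm1.
  by move=> /orbitA_eq <-; rewrite sum_exponent_on.
split=> [H E ET|H t q tqT].
  have /[!inE]/cards2P[t [q [_ Etq]]] := transversal_basis ET.
  rewrite Etq in ET *; rewrite sumE //; have [Hout Hin] := H _ _ ET.
  have [tqO|tqO] := boolP ([set C^-1 t; C^-1 q] \in orbitA theta [set t; q]).
    by rewrite fixed // Hin // GRing.subrr.
  by rewrite imC Hout // GRing.subrr.
have /eqP := H _ tqT; rewrite sumE // GRing.subr_eq0 => /eqP Hb.
by split=> tqO; rewrite -Hb; [rewrite imC | rewrite fixed].
Qed.

End Orbits.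

(** * Conjugacy *)

Lemma conj_twisted n (beta g : braid_ab n) c v :
  g * beta * g^-1 = beta * prodA c ->
  g * (beta * prodA v) * g^-1 =
  beta * prodA (fun E => c E + v (sigma_bar g @: E))%R.
Proof.
move=> gb; rewrite prodA_add [RHS]mulgA -gb -prodA_conj.
by rewrite !mulgA mulgVK.
Qed.

Lemma conj_prodA n (beta : braid_ab n) a v :
  prodA a * (beta * prodA v) * (prodA a)^-1 =
  beta * prodA (fun E => a (sigma_bar beta^-1 @: E) - a E + v E)%R.
Proof.
rewrite (@conj_twisted _ _ _ (fun E => a (sigma_bar beta^-1 @: E) - a E)%R).
  by congr (_ * _); apply: eq_prodA => E _; rewrite sigma_bar_prodA imset_perm1.
rewrite prodA_add -prodA_conj invgK.
have -> : (prodA a)^-1 = prodA (fun E => - a E)%R.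
  apply: mulg1_eq; rewrite -prodA_add -prodA0.
  by apply: eq_prodA => E _; rewrite GRing.addrN.
by rewrite !mulgA mulgV mul1g.
Qed.

(** The two sides have the same permutation, so they differ by a pure element. *)
Lemma conj_beta_cent n (beta g : braid_ab n) :
  sigma_bar g \in 'C[sigma_bar beta^-1] ->
  exists c, g * beta * g^-1 = beta * prodA c.
Proof.
have sV (x : braid_ab n) : sigma_bar x^-1 = (sigma_bar x)^-1 by rewrite gmulfV.
rewrite sV => /cent1P gC.
have [|c bc] := @pure_prodA n (beta^-1 * (g * beta * g^-1)).
  by rewrite !gmulfM /= !sV !mulgA -gC mulgVK mulgV.
by exists c; rewrite -bc mulVKg.
Qed.

Lemma sigma_bar_beta_prodA n (beta : braid_ab n) v :
  sigma_bar (beta * prodA v) = sigma_bar beta.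
Proof. by rewrite gmulfM /= sigma_bar_prodA mulg1. Qed.

Theorem theorem1p2 (n : nat) (hn : 3 <= n) (beta : braid_ab n)
    (theta : 'S_n) (htheta : theta = sigma_bar beta^-1)
    (T : {set {set 'I_n}}) (hT : transversalA theta T)
    (z b : {set 'I_n} -> int) :
  conjugated (beta * prodA_on T z) (beta * prodA_on T b) <->
  exists (Ct : braid_ab n) (C : 'S_n) (c : {set 'I_n} -> int),
    [/\ C = sigma_bar Ct,
        C \in 'C[theta],
        Ct * beta * Ct^-1 = beta * prodA c
      & forall t q : 'I_n, [set t; q] \in T ->
          ([set C^-1 t; C^-1 q] \notin orbitA theta [set t; q] ->
             (\sum_(E in orbitA theta [set t; q]) c E
              + \sum_(E in orbitA theta [set C t; C q]) exponent_on T z E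
              = b [set t; q])%R) /\
          ([set C^-1 t; C^-1 q] \in orbitA theta [set t; q] ->
             (\sum_(E in orbitA theta [set t; q]) c E + z [set t; q]
              = b [set t; q])%R)].
Proof.
rewrite !prodA_onE; split=> [[g gzb]|[g [_ [c [-> gC gb]]]]]; last first.
  move=> /(orbit_conditions hT c z b gC) H.
  (* Minus the defect of the orbit sums; it is set to 0 off the 2-element sets so
     that all its orbit sums vanish. *)
  pose f E := (if E \in basisA n then
     exponent_on T b E - (c E + exponent_on T z (sigma_bar g @: E)) else 0)%R.
  have theta_inj : injective (fun E : {set 'I_n} => theta @: E).
    exact: imset_inj (@perm_inj _ theta).
  have [|a af] := coboundary_of_orbit_sums (f := f) theta_inj.
    move=> E; rewrite -(eq_bigl _ _ (orbitA_fingraph theta E)).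
    have [EB|EB] := boolP (E \in basisA n); last first.
      by rewrite big1 // => F /orbitA_basis FE; rewrite /f FE (negPf EB).
    have [R RT <-] := transversal_repr hT EB.
    rewrite -[RHS]GRing.oppr0 -[in RHS](H R RT) -GRing.sumrN.
    apply: eq_bigr => F /orbitA_basis FR.
    by rewrite /f FR (transversal_basis hT RT) GRing.opprB.
  (* g alone gives exponents with the orbit sums of b; A^a corrects them within
     each orbit. *)
  exists (prodA a * g).
  have -> (w : braid_ab n) : prodA a * g * w * (prodA a * g)^-1 =
      prodA a * (g * w * g^-1) * (prodA a)^-1.
    by rewrite invgM !mulgA.
  rewrite (conj_twisted _ gb) conj_prodA -htheta; congr (_ * _).
  apply: eq_prodA => E EB; rewrite af /f EB; lia.
have gC : sigma_bar g \in 'C[theta].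
  have := congr1 (@sigma_bar n) gzb; rewrite gmulfM gmulfM /= !sigma_bar_beta_prodA.
  rewrite htheta !gmulfV /= => gb; apply/cent1P/commuteV.
  by rewrite /commute -[in RHS]gb mulgVK.
have [c gb] : exists c, g * beta * g^-1 = beta * prodA c.
  by apply: conj_beta_cent; rewrite -htheta.
exists g, (sigma_bar g), c; split=> //.
apply/(orbit_conditions hT c z b gC) => E ET.
have := esym gzb; rewrite (conj_twisted _ gb) => /mulgI/prodA_inj bE.
rewrite big1 // => F /orbitA_basis FE.
by rewrite -bE ?GRing.subrr // FE (transversal_basis hT).
Qed.
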